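(* Let $\mathbb{F}$ be a field with involution $\overline{\,\cdot\,}$, let $m,n\ge 1$, let $x,y\in\mathbb{F}^m$ and $z,w\in\mathbb{F}^n$ be column vectors with all entries nonzero, let $a,b\in\mathbb{F}\setminus\{0\}$, and let $$M=\left[\begin{array}{cc|cc}0&x^T&a&0\\ y&0&0&0\\ \hline b&0&0&z^T\\ 0&0&w&0\end{array}\right]$$ (a square matrix of order $m+n+2$). Assume $x^Ty=z^Tw=0$ and that $M^\dagger$ and the dual core EP inverse $M_{\mathrm{cEP}}$ both exist (equivalently, the scalars $s=x^*x$, $u=y^*y$, $t=z^*z$, $v=w^*w$, $p=b\overline{b}+z^*z$, $q=a\overline{a}+x^*x$ are all nonzero). Then the $^*$CEPMP inverse of $M$ is $$M_{\mathrm{cEP},\dagger}=\left[\begin{array}{cc|cc}0&0&\overline{b}p^{-1}&0\\ q^{-1}\overline{x}&0&0&0\\ \hline \overline{a}q^{-1}&0&0&0\\ 0&0&p^{-1}\overline{z}&0\end{array}\right].$$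
   Context: For a matrix $A=[a_{ij}]$ over a field $\mathbb{F}$ with involution $\overline{\,\cdot\,}$ (a field automorphism with $\overline{\overline{c}}=c$), $\overline{A}=[\overline{a_{ij}}]$ and $A^*=\overline{A}^{\,T}$. All $4\times4$ block matrices have rows and columns partitioned with sizes $1,m,1,n$; each $0$ is a zero block of the appropriate size. Matrices $M$ of the displayed form are the matrices whose associated digraph is a double star digraph, in canonical form. The Moore–Penrose inverse $A^\dagger$ is the unique $X$ (if it exists) with $AXA=A$, $XAX=X$, $(AX)^*=AX$, $(XA)^*=XA$. A square matrix $A$ is dual core EP invertible if there is $X$ with $A^{k+1}X=A^k$ for some nonnegative integer $k$, $X^2A=X$, $(XA)^*=XA$; such $X$ is unique, called the dual core EP inverse and denoted $A_{\mathrm{cEP}}$. When $A^\dagger$ and $A_{\mathrm{cEP}}$ exist, the $^*$CEPMP ($^*$core EP–Moore–Penrose) inverse of $A$ is the unique $X$ with $XAX=X$, $AX=AA_{\mathrm{cEP}}AA^\dagger$, $XA=A_{\mathrm{cEP}}A$; explicitly $A_{\mathrm{cEP},\dagger}=A_{\mathrm{cEP}}AA^\dagger$. *)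

(* Defs.v *)
From HB Require Import structures.
From mathcomp Require Import all_boot all_order all_algebra.

Set Implicit Arguments.
Unset Strict Implicit.
Unset Printing Implicit Defensive.

Import GRing.Theory.

Local Open Scope ring_scope.
Local Open Scope sesquilinear_scope.

(* A field with involution is a fieldType F with sigma : involutive_rmorphism F
   (possibly the identity); the conjugate transpose of A is A ^t sigma. *)

Definition is_MP_inverse (F : fieldType) (sigma : involutive_rmorphism F)
    (m n : nat) (A : 'M[F]_(m, n)) (X : 'M[F]_(n, m)) : Prop :=
  [/\ A *m X *m A = A, X *m A *m X = X,
      (A *m X) ^t sigma = A *m X & (X *m A) ^t sigma = X *m A].

Definition is_dual_core_EP_inverse (F : fieldType)
    (sigma : involutive_rmorphism F) (n : nat) (A X : 'M[F]_n) : Prop :=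
  [/\ exists k : nat, A ^+ k.+1 *m X = A ^+ k,
      X ^+ 2 *m A = X & (X *m A) ^t sigma = X *m A].

(* D and P are unique (see below), so they are the dual core EP inverse and the
   Moore-Penrose inverse of A; no X qualifies if either of them is missing. *)
Definition is_starCEPMP_inverse (F : fieldType)
    (sigma : involutive_rmorphism F) (n : nat) (A X : 'M[F]_n) : Prop :=
  exists D P : 'M[F]_n,
    [/\ is_dual_core_EP_inverse sigma A D, is_MP_inverse sigma A P &
      [/\ X *m A *m X = X, A *m X = A *m D *m A *m P & X *m A = D *m A]].

Definition double_star_mx (F : fieldType) (m n : nat) (a b : F)
    (x y : 'cV[F]_m) (z w : 'cV[F]_n) : 'M[F]_((1 + m) + (1 + n)) :=
  block_mx (block_mx 0     x^T
                     y     0)      (block_mx a%:M  0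
                                             0     0)
           (block_mx b%:M  0
                     0     0)      (block_mx 0     z^T
                                             w     0).

Definition sqnorm (F : fieldType) (sigma : involutive_rmorphism F) (n : nat)
    (x : 'cV[F]_n) : F := (x ^t sigma *m x) 0 0.

Section Uniqueness.

Variables (F : fieldType) (sigma : involutive_rmorphism F).

Let star_mulmx m n p (A : 'M[F]_(m, n)) (B : 'M[F]_(n, p)) :
  (A *m B) ^t sigma = B ^t sigma *m A ^t sigma.
Proof. by rewrite trmx_mul map_mxM. Qed.

Lemma MP_inverse_unique m n (A : 'M[F]_(m, n)) (X Y : 'M[F]_(n, m)) :
  is_MP_inverse sigma A X -> is_MP_inverse sigma A Y -> X = Y.
Proof.
move=> [AXA XAX AXs XAs] [AYA YAY AYs YAs].
have eAX : A *m X = A *m Y.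
  by rewrite -AXs -{1}AYA -(mulmxA (A *m Y)) star_mulmx AXs AYs mulmxA AXA.
have eXA : X *m A = Y *m A.
  by rewrite -XAs -{1}AYA -(mulmxA A Y A) mulmxA star_mulmx XAs YAs
             -(mulmxA Y) (mulmxA A) AXA.
by rewrite -XAX eXA -mulmxA eAX mulmxA YAY.
Qed.

Let cEP_expand n (A X : 'M[F]_n) j :
  X ^+ 2 *m A = X -> X ^+ j.+1 *m A ^+ j = X.
Proof.
move=> XXA; elim: j => [|j IHj]; first by rewrite expr0 expr1; exact: mulmx1.
have -> : X ^+ j.+2 *m A ^+ j.+1 = X *m (X ^+ j.+1 *m A ^+ j) *m A.
  have -> : X ^+ j.+2 = X *m X ^+ j.+1 by exact: exprS.
  have -> : A ^+ j.+1 = A ^+ j *m A by exact: exprSr.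
  by rewrite !mulmxA.
by rewrite IHj.
Qed.

Let cEP_mulK n (A X Y : 'M[F]_n) :
  is_dual_core_EP_inverse sigma A X -> is_dual_core_EP_inverse sigma A Y ->
  X *m A *m Y = X.
Proof.
move=> [_ XXA _] [[k AkY] _ _].
have -> : X *m A *m Y = X ^+ k.+1 *m (A ^+ k.+1 *m Y).
  have -> : A ^+ k.+1 = A ^+ k *m A by exact: exprSr.
  by rewrite !mulmxA (cEP_expand k XXA).
by rewrite AkY cEP_expand.
Qed.

Lemma dual_core_EP_inverse_unique n (A X Y : 'M[F]_n) :
  is_dual_core_EP_inverse sigma A X -> is_dual_core_EP_inverse sigma A Y ->
  X = Y.
Proof.
move=> hX hY; have [_ _ XAs] := hX; have [_ _ YAs] := hY.
have eXA : X *m A = Y *m A.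
  rewrite -[in RHS]YAs -[in RHS](cEP_mulK hY hX) -(mulmxA _ X) star_mulmx.
  rewrite XAs YAs.
  by rewrite mulmxA (cEP_mulK hX hY).
by rewrite -(cEP_mulK hX hY) eXA (cEP_mulK hY hY).
Qed.

Lemma starCEPMP_inverseE n (A D P X : 'M[F]_n) :
  is_dual_core_EP_inverse sigma A D -> is_MP_inverse sigma A P ->
  is_starCEPMP_inverse sigma A X <-> X = D *m A *m P.
Proof.
move=> hD hP; split=> [[D' [P' [hD' hP' [XAX AX XA]]]]|->].
  rewrite (dual_core_EP_inverse_unique hD hD') (MP_inverse_unique hP hP').
  by rewrite -XAX -mulmxA AX !mulmxA XA (cEP_mulK hD' hD').
have [APA _ _ _] := hP; have DAD := cEP_mulK hD hD.
have eXA : D *m A *m P *m A = D *m A by rewrite -!mulmxA (mulmxA A) APA.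
exists D, P; split=> //; split=> //; first by rewrite eXA !mulmxA DAD.
by rewrite !mulmxA.
Qed.

End Uniqueness.

(* Main.v *)
Require Import Defs.
From HB Require Import structures.
From mathcomp Require Import all_boot all_order all_algebra.

Set Implicit Arguments.
Unset Strict Implicit.
Unset Printing Implicit Defensive.

Import GRing.Theory.

Local Open Scope ring_scope.

(** Write [A^H] for the conjugate transpose of [A], and let [f], [g] be the rows
    of [M] at its two hubs, [f = (0, x^T, a, 0)] and [g = (b, 0, 0, z^T)].

    Since [x^T y = z^T w = 0], multiplication by [M] swaps the lines of [f] and
    [g]: [f M = a g] and [g M = b f]; moreover all rows of [M^2] are
    combinations of [f] and [g].  So [f] and [g] span the row space of every
    power of [M] from the second on.  A dual core EP inverse [D] must make
    [D M] the Hermitian projection onto that span.  As [f g^H = 0], this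
    projection exists exactly when [q = f f^H] and [p = g g^H] are nonzero, and
    then [D M = q^-1 f^H f + p^-1 g^H g].  See [swap_cEP_mul], [swap_cEPP] and
    [swap_cEP_gram], assembled in [double_star_dual_core_EPP].

    The matrix [M] has rank four.  In a full rank factorization [M = C G R] with
    [G] invertible, [M] has a Moore-Penrose inverse exactly when the Gram
    matrices [C^H C] and [R R^H] are invertible ([MP_inverse_exists]).  Here
    the columns of [C] are the hubs and the leaf vectors [y], [w], the rows of
    [R] are the hubs and the leaf vectors [x], [z], and the Gram matrices are
    [diag (1, u, 1, v)] and [diag (1, s, 1, t)] ([double_star_MPP]).

    The inverse sought is [D M P] with [P] the Moore-Penrose inverse.  The hub
    basis vectors lie in the column space of [M], so the projection [M P] fixes
    them; as [f], [g] are the hub rows of [M], this reads [f P = e1] and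
    [g P = e3] for the unit rows at the hubs ([hub_rows_MP]).  Hence
    [D M P = q^-1 f^H e1 + p^-1 g^H e3], which is the displayed matrix. *)

Local Open Scope sesquilinear_scope.

(** * Conjugate transposes and Hermitian projections *)

Section Adjoint.

Variables (F : fieldType) (sigma : involutive_rmorphism F).

Lemma starM m n p (A : 'M[F]_(m, n)) (B : 'M[F]_(n, p)) :
  (A *m B) ^t sigma = B ^t sigma *m A ^t sigma.
Proof. by rewrite trmx_mul map_mxM. Qed.

Lemma starD m n (A B : 'M[F]_(m, n)) :
  (A + B) ^t sigma = A ^t sigma + B ^t sigma.
Proof. by rewrite linearD /= map_mxD. Qed.

Lemma starZ m n c (A : 'M[F]_(m, n)) :
  (c *: A) ^t sigma = sigma c *: A ^t sigma.
Proof. by rewrite linearZ /= map_mxZ. Qed.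

Lemma starK m n (A : 'M[F]_(m, n)) : (A ^t sigma) ^t sigma = A.
Proof. by apply/matrixP=> i j; rewrite !mxE rmorphK. Qed.

Lemma star1 n : (1%:M : 'M[F]_n) ^t sigma = 1%:M.
Proof. by rewrite tr_scalar_mx map_scalar_mx rmorph1. Qed.

Lemma star0 m n : (0 : 'M[F]_(m, n)) ^t sigma = 0.
Proof. by rewrite trmx0 map_mx0. Qed.

(** A Hermitian [E] that fixes the rows of [R] and whose own rows are
    combinations [B *m R] of them satisfies [R = R *m E^H = (R *m R^H) *m B^H],
    so the independence of the rows of [R] passes to their Gram matrix. *)
Lemma gram_unit r n (R : 'M[F]_(r, n)) (B : 'M_(n, r)) (R' : 'M_(n, r))
    (E : 'M_n) :
  E ^t sigma = E -> R *m E = R -> E = B *m R -> R *m R' = 1%:M ->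
  R *m R ^t sigma \in unitmx.
Proof.
move=> Es RE EBR RR'.
suff : R *m R ^t sigma *m (B ^t sigma *m R') = 1%:M by case/mulmx1_unit.
by rewrite mulmxA -(mulmxA R) -starM -EBR Es RE.
Qed.

Lemma is_MP_inverse_star m n (A : 'M[F]_(m, n)) P :
  is_MP_inverse sigma A P ->
  is_MP_inverse sigma (A ^t sigma) (P ^t sigma).
Proof.
move=> [APA PAP APs PAs]; split; rewrite -?starM.
- by rewrite mulmxA APA.
- by rewrite mulmxA PAP.
- by rewrite PAs.
- by rewrite APs.
Qed.

(** With [A = C *m R], [P *m A] is a Hermitian projection of the kind
    [gram_unit] asks for: it fixes the rows of [A], whose span is that of the
    rows of [R]. *)
Lemma MP_inverse_row_gram m n r (C : 'M[F]_(m, r)) (R : 'M_(r, n)) L R' P :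
  L *m C = 1%:M -> R *m R' = 1%:M -> is_MP_inverse sigma (C *m R) P ->
  R *m R ^t sigma \in unitmx.
Proof.
move=> LC RR' [APA _ _ PAs].
apply: (@gram_unit _ _ R (P *m C) R' (P *m (C *m R))) => //.
- have {1}-> : R = L *m (C *m R) by rewrite mulmxA LC mul1mx.
  by rewrite -mulmxA (mulmxA _ P) APA mulmxA LC mul1mx.
- by rewrite mulmxA.
Qed.

(** When the Gram matrices [K] of [C] and [H] of [R] are invertible, the product
    of the one-sided inverses [K^-1 C^H] of [C] and [R^H H^-1] of [R] around
    [G^-1] is the Moore-Penrose inverse. Conversely, the row argument applies to
    the matrix and to its adjoint. The middle factor [G] leaves room to choose
    [C] and [R] with simple Gram matrices. *)
Lemma MP_inverse_exists m n r (C : 'M[F]_(m, r)) (G : 'M_r) (R : 'M_(r, n))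
    L R' :
  G \in unitmx -> L *m C = 1%:M -> R *m R' = 1%:M ->
  (exists P, is_MP_inverse sigma (C *m G *m R) P) <->
  (C ^t sigma *m C \in unitmx /\ R *m R ^t sigma \in unitmx).
Proof.
move=> Gu LC RR'; split=> [[P hP] | [uC uR]].
  split; last first.
    apply: (@MP_inverse_row_gram _ _ _ (C *m G) R (invmx G *m L) R' P) => //.
    by rewrite mulmxA -(mulmxA _ L) LC mulmx1 mulVmx.
  rewrite -{2}(starK C).
  apply: (@MP_inverse_row_gram _ _ _ ((G *m R) ^t sigma) (C ^t sigma)
            ((R' *m invmx G) ^t sigma) (L ^t sigma) (P ^t sigma)).
  - by rewrite -starM mulmxA -(mulmxA G) RR' mulmx1 mulmxV // star1.
  - by rewrite -starM LC star1.
  - by rewrite -starM mulmxA; apply: is_MP_inverse_star.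
set K := C ^t sigma *m C; set H := R *m R ^t sigma.
have Ks : (invmx K) ^t sigma = invmx K.
  by rewrite trmx_inv map_invmx starM starK.
have Hs : (invmx H) ^t sigma = invmx H.
  by rewrite trmx_inv map_invmx starM starK.
set P := R ^t sigma *m invmx H *m invmx G *m invmx K *m C ^t sigma.
have AP : C *m G *m R *m P = C *m invmx K *m C ^t sigma.
  rewrite /P !mulmxA -(mulmxA _ R) -/H -(mulmxA _ H) mulmxV // mulmx1.
  by rewrite -(mulmxA C G) mulmxV // mulmx1.
have PA : P *m (C *m G *m R) = R ^t sigma *m invmx H *m R.
  rewrite /P !mulmxA -(mulmxA _ _ C) -/K -(mulmxA _ _ K) mulVmx // mulmx1.
  by rewrite -(mulmxA _ _ G) mulVmx // mulmx1.
exists P; split.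
- rewrite AP !mulmxA -(mulmxA _ _ C) -/K -(mulmxA _ _ K) mulVmx //.
  by rewrite mulmx1.
- rewrite PA /P !mulmxA -(mulmxA _ R) -/H -(mulmxA _ _ H) mulVmx //.
  by rewrite mulmx1.
- by rewrite AP !starM starK Ks !mulmxA.
- by rewrite PA !starM starK Hs !mulmxA.
Qed.

(** [A *m P] is a Hermitian projection that fixes the column space of [A],
    so, acting from the right, it fixes the adjoints of the vectors there. *)
Lemma MP_inverse_fix m n k (A : 'M[F]_(m, n)) P (H : 'M_(n, k)) :
  is_MP_inverse sigma A P ->
  (A *m H) ^t sigma *m A *m P = (A *m H) ^t sigma.
Proof.
move=> [APA _ APs _]; rewrite -mulmxA -{1}APs -starM.
by rewrite mulmxA APA.
Qed.

End Adjoint.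

(** * The dual core EP inverse of a matrix that swaps two orthogonal lines *)

Section SwapRows.

Variables (F : fieldType) (sigma : involutive_rmorphism F) (n : nat).
Variables (A : 'M[F]_n) (f g : 'rV[F]_n) (c d : 'cV[F]_n) (a b q p : F).

Hypotheses (a0 : a != 0) (b0 : b != 0).
Hypotheses (fA : f *m A = a *: g) (gA : g *m A = b *: f).
Hypothesis AA : A *m A = c *m f + d *m g.
Hypotheses (ff : f *m f ^t sigma = q%:M) (gg : g *m g ^t sigma = p%:M).
Hypothesis fg : f *m g ^t sigma = 0.

Let gf : g *m f ^t sigma = 0.
Proof. by rewrite -[LHS](starK sigma) starM starK fg star0. Qed.

Let expr2mx : A ^+ 2 = A *m A.
Proof. by []. Qed.

Let sigma_q : sigma q = q.
Proof.
have: (f *m f ^t sigma) ^t sigma = f *m f ^t sigma by rewrite starM starK.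
by rewrite ff tr_scalar_mx map_scalar_mx => /matrixP/(_ 0 0); rewrite !mxE.
Qed.

Let sigma_p : sigma p = p.
Proof.
have: (g *m g ^t sigma) ^t sigma = g *m g ^t sigma by rewrite starM starK.
by rewrite gg tr_scalar_mx map_scalar_mx => /matrixP/(_ 0 0); rewrite !mxE.
Qed.

(** The Hermitian projection onto the rows [f], [g], followed by the inverse of
    the swap that [A] performs on their span. *)
Definition swap_cEP : 'M[F]_n :=
  (b * q)^-1 *: (f ^t sigma *m g) + (a * p)^-1 *: (g ^t sigma *m f).

Lemma swap_cEP_mul : swap_cEP *m A =
  q^-1 *: (f ^t sigma *m f) + p^-1 *: (g ^t sigma *m g).
Proof.
rewrite mulmxDl -!scalemxAl -!mulmxA fA gA -!scalemxAr !scalerA.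
by rewrite !invfM mulrAC mulVf // mul1r mulrAC mulVf // mul1r.
Qed.

Lemma swap_cEPP : q != 0 -> p != 0 ->
  is_dual_core_EP_inverse sigma A swap_cEP.
Proof.
move=> q0 p0.
have fD : f *m swap_cEP = b^-1 *: g.
  rewrite mulmxDr -!scalemxAr !mulmxA ff fg mul0mx scaler0 addr0.
  by rewrite mul_scalar_mx scalerA invfM mulfVK.
have gD : g *m swap_cEP = a^-1 *: f.
  rewrite mulmxDr -!scalemxAr !mulmxA gg gf mul0mx scaler0 add0r.
  by rewrite mul_scalar_mx scalerA invfM mulfVK.
have fAD : f *m A *m swap_cEP = f.
  by rewrite fA -scalemxAl gD scalerA mulfV ?scale1r.
have gAD : g *m A *m swap_cEP = g.
  by rewrite gA -scalemxAl fD scalerA mulfV ?scale1r.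
have fDA : f *m swap_cEP *m A = f.
  by rewrite fD -scalemxAl gA scalerA mulVf ?scale1r.
have gDA : g *m swap_cEP *m A = g.
  by rewrite gD -scalemxAl fA scalerA mulVf ?scale1r.
split.
(* From the second power on, all rows are combinations of [f] and [g]. *)
- exists 2; have -> : A ^+ 3 = A *m A *m A by exact: exprSr.
  rewrite expr2mx AA -[_ *m A *m _]mulmxA mulmxDl -!(mulmxA _ _ (A *m _)).
  by rewrite !(mulmxA _ A) fAD gAD.
- have -> : swap_cEP ^+ 2 = swap_cEP *m swap_cEP by [].
  rewrite -mulmxA {1}/swap_cEP mulmxDl -!scalemxAl.
  by rewrite -!(mulmxA _ _ (swap_cEP *m _)) !(mulmxA _ swap_cEP) fDA gDA.
- rewrite swap_cEP_mul starD !starZ !starM !starK !fmorphV /=.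
  by rewrite sigma_q sigma_p.
Qed.

(** The rows [f] and [g] lie in the row space of every power of [A], where a
    dual core EP inverse undoes [A]. *)
Lemma swap_cEP_fix D :
  is_dual_core_EP_inverse sigma A D -> f *m D *m A = f /\ g *m D *m A = g.
Proof.
move=> [[k AkD] _ _].
have rows j : (exists h, f = h *m A ^+ j) /\ (exists h, g = h *m A ^+ j).
  elim: j => [|j [[h fh] [h' gh]]].
    by split; [exists f | exists g]; rewrite expr0; exact/esym/mulmx1.
  have -> : A ^+ j.+1 = A ^+ j *m A by exact: exprSr.
  split; [exists (b^-1 *: h') | exists (a^-1 *: h)].
    by rewrite -scalemxAl mulmxA -gh gA scalerA mulVf ?scale1r.
  by rewrite -scalemxAl mulmxA -fh fA scalerA mulVf ?scale1r.
have fix_ h : h *m A ^+ k *m (A *m D) = h *m A ^+ k.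
  rewrite mulmxA -(mulmxA h).
  have -> : A ^+ k *m A = A ^+ k.+1 by exact/esym/exprSr.
  by rewrite -mulmxA AkD.
have [[[h fh] [h' gh]]] := rows k.
have gD : a *: (g *m D) = f by rewrite scalemxAl -fA fh -mulmxA fix_.
have fD : b *: (f *m D) = g by rewrite scalemxAl -gA gh -mulmxA fix_.
split.
- by apply: (scalerI b0); rewrite scalemxAl fD gA.
- by apply: (scalerI a0); rewrite scalemxAl gD fA.
Qed.

(** With [E := D *m A], both conditions come from [f = f *m E^H] and
    [g = g *m E^H], because the rows of [E] are combinations of [f] and [g]. *)
Lemma swap_cEP_gram D : f != 0 -> g != 0 ->
  is_dual_core_EP_inverse sigma A D -> q != 0 /\ p != 0.
Proof.
move=> f0 g0 hD; have [fE gE] := swap_cEP_fix hD.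
have [_ DDA DAs] := hD.
set N := D *m D *m c; set K := D *m D *m d.
have E : D *m A = N *m f + K *m g.
  by rewrite -{1}DDA -mulmxA AA mulmxDr !mulmxA.
move: fE gE; rewrite -!mulmxA -DAs E starD !starM !mulmxDr !mulmxA.
rewrite ff fg gg gf !mul0mx addr0 add0r !mul_scalar_mx => fE gE.
split.
- by apply: contraNneq f0 => q0; rewrite -fE q0 scale0r !mul0mx.
- by apply: contraNneq g0 => p0; rewrite -gE p0 scale0r !mul0mx.
Qed.

End SwapRows.

(** * The double star matrix *)

Section DoubleStar.

Variable F : fieldType.

Lemma col_linv k (v : 'cV[F]_k) i : v i 0 != 0 -> exists r, r *m v = 1%:M.
Proof.
move=> vi; exists ((v i 0)^-1 *: delta_mx 0 i).
rewrite -scalemxAl -rowE [row i v]mx11_scalar mxE scale_scalar_mx.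
by rewrite mulVf.
Qed.

(** The columns, the two hubs and the two leaf vectors, have pairwise disjoint
    supports and are therefore orthogonal. *)
Definition spread m n (y : 'cV[F]_m) (w : 'cV[F]_n) :
    'M[F]_((1 + m) + (1 + n), (1 + 1) + (1 + 1)) :=
  block_mx (block_mx 1%:M 0 0 y) 0 0 (block_mx 1%:M 0 0 w).

Definition star_core (a b : F) : 'M[F]_((1 + 1) + (1 + 1)) :=
  block_mx (block_mx 0 1%:M 1%:M 0) (block_mx a%:M 0 0 0)
           (block_mx b%:M 0 0 0) (block_mx 0 1%:M 1%:M 0).

Lemma star_core_unit a b : star_core a b \in unitmx.
Proof.
pose K : 'M[F]_((1 + 1) + (1 + 1)) :=
  block_mx (block_mx 0 1%:M 1%:M 0) (block_mx 0 0 0 (- a)%:M)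
           (block_mx 0 0 0 (- b)%:M) (block_mx 0 1%:M 1%:M 0).
suff : star_core a b *m K = 1%:M by case/mulmx1_unit.
rewrite /star_core /K !(mulmx_block, add_block_mx).
rewrite !(mul0mx, mulmx0, mul1mx, mulmx1, addr0, add0r).
by rewrite -!raddfD /= subrr addNr raddf0 block_mx0 !scalar_mx_block.
Qed.

(** The leaves of each star enter only through the sums weighted by [x] or [z]
    and receive multiples of [y] or [w]; in these four coordinates the matrix
    exchanges each hub with its leaves and adds the two edges between hubs. *)
Lemma double_star_factor m n a b (x y : 'cV[F]_m) (z w : 'cV[F]_n) :
  double_star_mx a b x y z w = spread y w *m star_core a b *m (spread x z)^T.
Proof.
have simpl0 := (trmx0, tr_scalar_mx, mul0mx, mulmx0, mul1mx, mulmx1, addr0,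
                add0r).
rewrite /spread /star_core !tr_block_mx.
by do 2!rewrite !(mulmx_block, add_block_mx) !simpl0.
Qed.

Lemma spread_linv m n (y : 'cV[F]_m) (w : 'cV[F]_n) i j :
  y i 0 != 0 -> w j 0 != 0 -> exists L, L *m spread y w = 1%:M.
Proof.
move=> /col_linv[r ry] /col_linv[s sw].
exists (block_mx (block_mx 1%:M 0 0 r) 0 0 (block_mx 1%:M 0 0 s)).
rewrite /spread !(mulmx_block, add_block_mx) ry sw.
rewrite !(mul0mx, mulmx0, mul1mx, addr0, add0r).
by rewrite !scalar_mx_block.
Qed.

Variable sigma : involutive_rmorphism F.

Lemma sqnormE n (x : 'cV[F]_n) : x ^t sigma *m x = (sqnorm sigma x)%:M.
Proof. exact: mx11_scalar. Qed.

Lemma sqnorm_tr n (x : 'cV[F]_n) :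
  x^T *m map_mx sigma x = (sqnorm sigma x)%:M.
Proof.
rewrite [LHS]mx11_scalar /sqnorm; congr _%:M; rewrite !mxE.
by apply: eq_bigr => i _; rewrite !mxE mulrC.
Qed.

Lemma spread_gram m n (y : 'cV[F]_m) (w : 'cV[F]_n) :
  (spread y w) ^t sigma *m spread y w \in unitmx =
  (sqnorm sigma y != 0) && (sqnorm sigma w != 0).
Proof.
rewrite unitmxE /spread !(tr_block_mx, map_block_mx).
rewrite !(trmx0, map_mx0, star1) !(mulmx_block, add_block_mx).
rewrite !(mul0mx, mulmx0, mul1mx, addr0, add0r) !sqnormE.
by rewrite !det_ublock !det1 !det_scalar1 !mul1r unitfE mulf_eq0 negb_or.
Qed.

(** The Gram matrix of the rows of a transpose is the transpose of the Gram
    matrix of the columns. *)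
Lemma spread_tr_gram m n (x : 'cV[F]_m) (z : 'cV[F]_n) :
  (spread x z)^T *m ((spread x z)^T) ^t sigma \in unitmx =
  (sqnorm sigma x != 0) && (sqnorm sigma z != 0).
Proof.
by rewrite -spread_gram -[LHS]unitmx_tr trmx_mul !trmxK map_trmx.
Qed.

Lemma double_star_MPP m n a b (x y : 'cV[F]_m) (z w : 'cV[F]_n) i j :
  x i 0 != 0 -> y i 0 != 0 -> z j 0 != 0 -> w j 0 != 0 ->
  (exists P, is_MP_inverse sigma (double_star_mx a b x y z w) P) <->
  [/\ sqnorm sigma x != 0, sqnorm sigma y != 0, sqnorm sigma z != 0
    & sqnorm sigma w != 0].
Proof.
move=> xi yi zj wj; rewrite double_star_factor.
have [L LC] := spread_linv yi wj; have [R' RR'] := spread_linv xi zj.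
have RR'T : (spread x z)^T *m R'^T = 1%:M by rewrite -trmx_mul RR' trmx1.
have := MP_inverse_exists sigma (star_core_unit a b) LC RR'T.
rewrite spread_gram spread_tr_gram => -[to_gram of_gram]; split.
  by move=> /to_gram[/andP[-> ->] /andP[-> ->]].
by move=> [sx sy sz sw]; apply: of_gram; rewrite sx sy sz sw.
Qed.

Section Hubs.

Variables (m n : nat) (a b : F) (x y : 'cV[F]_m) (z w : 'cV[F]_n).

Let M := double_star_mx a b x y z w.

Definition hub1 : 'rV[F]_((1 + m) + (1 + n)) := row_mx (row_mx 1%:M 0) 0.
Definition hub2 : 'rV[F]_((1 + m) + (1 + n)) := row_mx 0 (row_mx 1%:M 0).
Definition hub_row1 : 'rV[F]_((1 + m) + (1 + n)) :=
  row_mx (row_mx 0 x^T) (row_mx a%:M 0).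
Definition hub_row2 : 'rV[F]_((1 + m) + (1 + n)) :=
  row_mx (row_mx b%:M 0) (row_mx 0 z^T).

Let block0 :=
  (mul0mx, mulmx0, mul1mx, mulmx1, addr0, add0r, @row_mx0 F, @col_mx0 F).

Lemma hub1_mul : hub1 *m M = hub_row1.
Proof. by rewrite /M /hub1 mul_row_block !mul_row_block !block0. Qed.

Lemma hub2_mul : hub2 *m M = hub_row2.
Proof. by rewrite /M /hub2 mul_row_block !mul_row_block !block0. Qed.

Lemma hub_row1_mul : x^T *m y = 0 -> hub_row1 *m M = a *: hub_row2.
Proof.
move=> xy; rewrite /M /hub_row1 mul_row_block !mul_row_block xy !block0.
by rewrite !mul_scalar_mx /hub_row2 !scale_row_mx !scaler0.
Qed.

Lemma hub_row2_mul : z^T *m w = 0 -> hub_row2 *m M = b *: hub_row1.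
Proof.
move=> zw; rewrite /M /hub_row2 mul_row_block !mul_row_block zw !block0.
by rewrite !mul_scalar_mx /hub_row1 !scale_row_mx !scaler0.
Qed.

Lemma double_star_sq : x^T *m y = 0 -> z^T *m w = 0 ->
  M *m M = col_mx (col_mx 0 y) (col_mx b%:M 0) *m hub_row1
         + col_mx (col_mx a%:M 0) (col_mx 0 w) *m hub_row2.
Proof.
move=> xy zw; rewrite /M /double_star_mx /hub_row1 /hub_row2.
by rewrite !mul_col_row !(mulmx_block, add_block_mx) xy zw !block0.
Qed.

Lemma hub_row1_norm :
  hub_row1 *m hub_row1 ^t sigma = (a * sigma a + sqnorm sigma x)%:M.
Proof.
rewrite /hub_row1 !(tr_row_mx, map_col_mx) !mul_row_col trmxK.
rewrite tr_scalar_mx map_scalar_mx !trmx0 !map_mx0 !block0 sqnorm_tr.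
by rewrite -scalar_mxM -raddfD addrC.
Qed.

Lemma hub_row2_norm :
  hub_row2 *m hub_row2 ^t sigma = (b * sigma b + sqnorm sigma z)%:M.
Proof.
rewrite /hub_row2 !(tr_row_mx, map_col_mx) !mul_row_col trmxK.
rewrite tr_scalar_mx map_scalar_mx !trmx0 !map_mx0 !block0 sqnorm_tr.
by rewrite -scalar_mxM -raddfD.
Qed.

Lemma hub_rows_ortho : hub_row1 *m hub_row2 ^t sigma = 0.
Proof.
rewrite /hub_row1 /hub_row2 !(tr_row_mx, map_col_mx) !mul_row_col.
by rewrite !trmx0 !map_mx0 !block0.
Qed.

Lemma double_star_dual_core_EPP : a != 0 -> b != 0 ->
  x^T *m y = 0 -> z^T *m w = 0 ->
  let p := b * sigma b + sqnorm sigma z in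
  let q := a * sigma a + sqnorm sigma x in
  (exists D, is_dual_core_EP_inverse sigma M D) <-> (p != 0 /\ q != 0).
Proof.
move=> a0 b0 xy zw p q.
have [fM gM] := (hub_row1_mul xy, hub_row2_mul zw).
have MM := double_star_sq xy zw.
split=> [[D hD] | [p0 q0]].
  have [||q0 p0] := swap_cEP_gram a0 b0 fM gM MM hub_row1_norm hub_row2_norm
                      hub_rows_ortho _ _ hD; last by split.
  - apply: contraNneq a0 => /eqP; rewrite !row_mx_eq0.
    by case/and3P=> _ /eqP/matrixP/(_ 0 0); rewrite !mxE mulr1n => ->.
  - apply: contraNneq b0 => /eqP; rewrite !row_mx_eq0 -andbA.
    by case/andP=> /eqP/matrixP/(_ 0 0); rewrite !mxE mulr1n => ->.
exists (swap_cEP sigma hub_row1 hub_row2 a b q p).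
exact: swap_cEPP a0 b0 fM gM MM hub_row1_norm hub_row2_norm
         hub_rows_ortho q0 p0.
Qed.

(** The hub basis columns lie in the column space of [M], since [M] sends a leaf
    with nonzero weight to a nonzero multiple of its hub. *)
Lemma hub_rows_MP i j P : x i 0 != 0 -> z j 0 != 0 ->
  is_MP_inverse sigma M P -> hub_row1 *m P = hub1 /\ hub_row2 *m P = hub2.
Proof.
move=> /col_linv[r rx] /col_linv[s sz] hP.
have xr : x^T *m r^T = 1%:M by rewrite -trmx_mul rx trmx1.
have zs : z^T *m s^T = 1%:M by rewrite -trmx_mul sz trmx1.
have MH1 : M *m col_mx (col_mx 0 r^T) 0 = hub1 ^t sigma.
  rewrite /M /hub1 mul_block_col !mul_block_col xr !block0.
  by rewrite !(tr_row_mx, map_col_mx) star1 !trmx0 !map_mx0.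
have MH2 : M *m col_mx 0 (col_mx 0 s^T) = hub2 ^t sigma.
  rewrite /M /hub2 mul_block_col !mul_block_col zs !block0.
  by rewrite !(tr_row_mx, map_col_mx) star1 !trmx0 !map_mx0.
have := MP_inverse_fix (col_mx (col_mx 0 r^T) 0) hP.
have := MP_inverse_fix (col_mx 0 (col_mx 0 s^T)) hP.
by rewrite MH1 MH2 !starK hub1_mul hub2_mul.
Qed.

End Hubs.

End DoubleStar.

Theorem lemma5p3 (F : fieldType) (sigma : involutive_rmorphism F) (m n : nat)
    (hm : (1 <= m)%N) (hn : (1 <= n)%N)
    (x y : 'cV[F]_m) (z w : 'cV[F]_n) (a b : F)
    (hx : forall i, x i 0 != 0) (hy : forall i, y i 0 != 0)
    (hz : forall i, z i 0 != 0) (hw : forall i, w i 0 != 0)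
    (ha : a != 0) (hb : b != 0)
    (hxy : x^T *m y = 0) (hzw : z^T *m w = 0) :
  let M := double_star_mx a b x y z w in
  let s := sqnorm sigma x in
  let u := sqnorm sigma y in
  let t := sqnorm sigma z in
  let v := sqnorm sigma w in
  let p := b * sigma b + sqnorm sigma z in
  let q := a * sigma a + sqnorm sigma x in
  let inverses_exist :=
    (exists P, is_MP_inverse sigma M P) /\
    (exists D, is_dual_core_EP_inverse sigma M D) in
  (inverses_exist <->
     [/\ s != 0, u != 0, t != 0 & v != 0] /\ (p != 0 /\ q != 0)) /\
  (inverses_exist ->
     forall X : 'M[F]_((1 + m) + (1 + n)),
       is_starCEPMP_inverse sigma M X <->
       X = block_mx
             (block_mx 0                       0
                       (q^-1 *: map_mx sigma x) 0)
             (block_mx (sigma b * p^-1)%:M     0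
                       0                       0)
             (block_mx (sigma a * q^-1)%:M     0
                       0                       0)
             (block_mx 0                       0
                       (p^-1 *: map_mx sigma z) 0)).
Proof.
move=> M s u t v p q inverses_exist.
pose i := Ordinal hm; pose j := Ordinal hn.
have MP := double_star_MPP sigma a b (hx i) (hy i) (hz j) (hw j).
have EP := double_star_dual_core_EPP sigma ha hb hxy hzw.
split; first by split=> -[/MP hP /EP hD].
move=> [[P hP] /EP[p0 q0]] X.
pose D := swap_cEP sigma (hub_row1 n a x) (hub_row2 m b z) a b q p.
have [fM gM] := (hub_row1_mul a b z w hxy, hub_row2_mul a b x y hzw).
have [fP gP] := hub_rows_MP (hx i) (hz j) hP.
have hD : is_dual_core_EP_inverse sigma M D.
  exact: (swap_cEPP ha hb fM gM (double_star_sq a b hxy hzw)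
            (hub_row1_norm _ _ _ _) (hub_row2_norm _ _ _ _)
            (hub_rows_ortho _ _ _ _ _)).
set Y := block_mx _ _ _ _.
suff <- : D *m M *m P = Y by apply: starCEPMP_inverseE.
rewrite (swap_cEP_mul sigma q p ha hb fM gM) mulmxDl -!scalemxAl -!mulmxA.
rewrite fP gP /hub_row1 /hub_row2 /hub1 /hub2 !(tr_row_mx, map_col_mx) !trmxK.
rewrite !tr_scalar_mx !map_scalar_mx !trmx0 !map_mx0 /Y !mul_col_row.
rewrite !(mul0mx, mulmx0, mulmx1) !(scale_block_mx, scaler0).
by rewrite !(add_block_mx, addr0, add0r) !scale_scalar_mx ![_^-1 * _]mulrC.
Qed.
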